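(* Let $A=\{1\text{-}32\text{-}4,\ 1\text{-}42\text{-}3,\ 2\text{-}31\text{-}4,\ 2\text{-}41\text{-}3\}$ and $B=\{1\text{-}3\text{-}2\text{-}4,\ 1\text{-}4\text{-}2\text{-}3,\ 2\text{-}3\text{-}1\text{-}4,\ 2\text{-}4\text{-}1\text{-}3\}$ be sets of (dashed) patterns. Then $\mathrm{Av}(A)=\mathrm{Av}(B)$; that is, a permutation avoids all patterns in $A$ if and only if it avoids all patterns in $B$.
   Context: A permutation of length $n$ is written in one-line notation $\sigma_1\sigma_2\cdots\sigma_n$, a rearrangement of $1,\dots,n$. A (dashed, generalized) pattern is a permutation $\pi_1\cdots\pi_k$ in which some or all of the adjacent elements may be separated by dashes. A subsequence $\sigma_{i_1}\sigma_{i_2}\cdots\sigma_{i_k}$ (with $i_1<i_2<\cdots<i_k$) of a permutation $\sigma$ is an occurrence of the pattern if (i) its elements have the same relative order as $\pi_1,\dots,\pi_k$ (i.e. $\sigma_{i_s}<\sigma_{i_t}$ if and only if $\pi_s<\pi_t$), and (ii) whenever there is no dash between the $j$th and $(j+1)$th elements of the pattern, the $j$th and $(j+1)$th elements of the subsequence occur consecutively in $\sigma$ (i.e. $i_{j+1}=i_j+1$). Where there is a dash, the corresponding elements may or may not be consecutive in $\sigma$. A permutation avoids a pattern if it contains no occurrence of it, and avoids a set of patterns if it contains no occurrence of any pattern in the set. For a set $S$ of patterns, $\mathrm{Av}(S)$ denotes the set of all permutations (of any length) that avoid $S$. *)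

(* Defs.v *)
From mathcomp Require Import all_boot all_fingroup.

Set Implicit Arguments.
Unset Strict Implicit.
Unset Printing Implicit Defensive.

(* The one-line word of [s : 'S_n] is [s 0, ..., s (n - 1)]; positions and
   values are numbered from 0, which does not affect relative order or
   adjacency. *)
Definition permutation := {n : nat & 'S_n}.

(* A dashed pattern is the list of its maximal dash-free factors, with letters
   numbered from 1: 1-32-4 is [:: [:: 1]; [:: 3; 2]; [:: 4]]. *)
Definition is_pattern (b : seq (seq nat)) : bool :=
  ([::] \notin b) && perm_eq (flatten b) (iota 1 (size (flatten b))).

Record pattern := Pattern { blocks : seq (seq nat); _ : is_pattern blocks }.

Definition plength (p : pattern) : nat := size (flatten (blocks p)).

Definition letter (p : pattern) (j : nat) : nat := nth 0 (flatten (blocks p)) j.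

(* No dash separates the letters at (0-based) positions j and j + 1. *)
Definition undashed (p : pattern) (j : nat) : bool :=
  reshape_index (shape (blocks p)) j == reshape_index (shape (blocks p)) j.+1.

Definition occurrence (n : nat) (s : 'S_n) (p : pattern)
    (i : {ffun 'I_(plength p) -> 'I_n}) : bool :=
  [&& [forall u : 'I_(plength p), forall v : 'I_(plength p),
         (u < v) ==> (i u < i v)],
      [forall u : 'I_(plength p), forall v : 'I_(plength p),
         (s (i u) < s (i v)) == (letter p u < letter p v)]
    & [forall u : 'I_(plength p), forall v : 'I_(plength p),
         (v == u.+1 :> nat) && undashed p u ==> (i v == (i u).+1 :> nat)]].

Definition avoids (n : nat) (s : 'S_n) (p : pattern) : bool :=
  ~~ [exists i : {ffun 'I_(plength p) -> 'I_n}, occurrence s i].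

Definition Av (S : seq pattern) : pred permutation :=
  [pred s | all (avoids (tagged s)) S].

Definition patternsA : seq pattern :=
  [:: @Pattern [:: [:: 1]; [:: 3; 2]; [:: 4]] isT;
      @Pattern [:: [:: 1]; [:: 4; 2]; [:: 3]] isT;
      @Pattern [:: [:: 2]; [:: 3; 1]; [:: 4]] isT;
      @Pattern [:: [:: 2]; [:: 4; 1]; [:: 3]] isT].

Definition patternsB : seq pattern :=
  [:: @Pattern [:: [:: 1]; [:: 3]; [:: 2]; [:: 4]] isT;
      @Pattern [:: [:: 1]; [:: 4]; [:: 2]; [:: 3]] isT;
      @Pattern [:: [:: 2]; [:: 3]; [:: 1]; [:: 4]] isT;
      @Pattern [:: [:: 2]; [:: 4]; [:: 1]; [:: 3]] isT].

(* Main.v *)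
Require Import Defs.
From mathcomp Require Import all_boot all_fingroup.
From mathcomp Require Import zify.

(** In each of the four patterns the letters 1 and 2 stand at the first and
    third places, so some pattern of B occurs at positions w < x < y < z iff
    s w and s y are both smaller than s x and s z; for A one asks in addition
    that y = x + 1.  Given such positions, put t = max (s w) (s y): since
    s x > t >= s y, some consecutive positions j, j + 1 between x and y
    satisfy s j > t >= s (j + 1), and (w, j, j + 1, z) is an occurrence of a
    pattern of A. *)

Set Implicit Arguments.
Unset Strict Implicit.
Unset Printing Implicit Defensive.

(** Indexing by [nat] with bounds, instead of by ['I_(plength p)], lets the positions of an
    occurrence be named [f 0], ..., [f 3] although [plength p] is 4 only propositionally. *)
Lemma containsP (n q : nat) (s : 'S_n) (p : pattern) :
  plength p = q.+1 ->
  reflect (exists f : nat -> 'I_n,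
    [/\ forall j k, j < k <= q -> f j < f k,
        forall j k, j <= q -> k <= q ->
          (s (f j) < s (f k)) = (letter p j < letter p k)
      & forall j, j < q -> undashed p j -> f j.+1 = (f j).+1 :> nat])
  (~~ avoids s p).
Proof.
move=> def_q; rewrite /avoids negbK.
apply: (iffP existsP) =>
  [[i /and3P[/'forall_forallP iP sP dP]]|[f [iP sP dP]]].
  pose c j : 'I_(plength p) := cast_ord (esym def_q) (inord j).
  have cK j : j <= q -> c j = j :> nat by move=> le_jq; rewrite /= inordK.
  exists (fun j => i (c j)).
  split=> [j k /andP[lt_jk le_kq]|j k le_jq le_kq|j lt_jq].
  - apply: (implyP (iP (c j) (c k))).
    by rewrite !cK // (leq_trans (ltnW lt_jk)).
  - move/'forall_forallP/(_ (c j) (c k))/eqP: sP => ->.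
    by rewrite !cK.
  - move/'forall_forallP/(_ (c j) (c j.+1))/implyP: dP => dP und.
    by apply/eqP/dP; rewrite !cK ?eqxx // ltnW.
have le_q (u : 'I_(plength p)) : u <= q by rewrite -ltnS -def_q.
exists [ffun u : 'I_(plength p) => f u].
apply/and3P; split; apply/'forall_forallP=> u v; rewrite !ffunE.
- by apply/implyP=> lt_uv; rewrite iP // lt_uv le_q.
- by rewrite sP ?le_q.
- apply/implyP=> /andP[/eqP def_v und].
  by rewrite def_v dP // -def_v le_q.
Qed.

Definition low_high (n : nat) (s : 'S_n) (w x y z : 'I_n) : bool :=
  [&& w < x, x < y, y < z & maxn (s w) (s y) < minn (s x) (s z)].

(** Erasing the dashes turns both A and B into these four words, in this order. *)
Definition low_high_words : seq (seq nat) :=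
  [:: [:: 1; 3; 2; 4]; [:: 1; 4; 2; 3]; [:: 2; 3; 1; 4]; [:: 2; 4; 1; 3]].

Lemma low_high_of_contains (n : nat) (s : 'S_n) (p : pattern) :
  flatten (blocks p) \in low_high_words -> ~~ avoids s p ->
  exists w x y z, low_high s w x y z /\ (undashed p 1 -> y = x.+1 :> nat).
Proof.
move=> p_in; have p4 : plength p = 4.
  by rewrite /plength; move: p_in; rewrite !inE => /or4P[] /eqP->.
case/(containsP s p4) => f [iP sP dP].
exists (f 0), (f 1), (f 2), (f 3); split; last exact: dP.
rewrite /low_high !iP //= gtn_max !leq_min !sP // /letter.
by move: p_in; rewrite !inE => /or4P[] /eqP->.
Qed.

(** The order within the low pair and within the high pair determines [l]. Any dashing of [l] is
    allowed whose only possible adjacency is between the middle letters, so the lemma serves both A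
    and B. *)
Lemma contains_of_low_high (n : nat) (s : 'S_n) (w x y z : 'I_n) :
  low_high s w x y z ->
  exists2 l, l \in low_high_words & forall p, flatten (blocks p) = l ->
    (forall j, j < 3 -> undashed p j -> j = 1 /\ y = x.+1 :> nat) ->
    ~~ avoids s p.
Proof.
case/and4P=> wx xy yz lh.
have neq (a b : 'I_n) : a < b -> s a <> s b :> nat.
  by move=> lt_ab /val_inj/perm_inj eq_ab; rewrite eq_ab ltnn in lt_ab.
have neq_wy := neq w y (ltn_trans wx xy).
have neq_xz := neq x z (ltn_trans xy yz).
exists (if s w < s y then if s x < s z then [:: 1; 3; 2; 4] else [:: 1; 4; 2; 3]
        else if s x < s z then [:: 2; 3; 1; 4] else [:: 2; 4; 1; 3]).
  by case: ifP => _; case: ifP.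
move=> p def_p dP; have p4 : plength p = 4.
  by rewrite /plength def_p; case: ifP => _; case: ifP.
(* The default [w] is never reached, as only indices up to 3 are inspected. *)
apply/(containsP s p4); exists (nth w [:: w; x; y; z]); split.
- by case=> [|[|[|[|j]]]] [|[|[|[|k]]]] //=; lia.
- rewrite /letter def_p => j k.
  by case: ifP => wy; case: ifP => xz; case: j => [|[|[|[|j]]]] //;
     case: k => [|[|[|[|k]]]] //= _ _; lia.
- by move=> j lt_j3 /(dP j lt_j3)[->].
Qed.

Lemma low_high_adjacent (n : nat) (s : 'S_n) (w x y z : 'I_n) :
  low_high s w x y z ->
  exists x' y', low_high s w x' y' z /\ y' = x'.+1 :> nat.
Proof.
case/and4P=> wx xy yz lh; pose t := maxn (s w) (s y).
(* The descent across [t] ends at the least position after [x] with value at most [t]; [y] is a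
   candidate. *)
have exP : exists j, (x < j) && [exists v : 'I_n, (v == j :> nat) && (s v <= t)].
  by exists y; rewrite xy; apply/existsP; exists y; rewrite eqxx leq_maxr.
case: (ex_minnP exP) => j /andP[xj /existsP[v /andP[/eqP def_v sv]]] minj.
have le_jy : j <= y.
  by apply: minj; rewrite xy; apply/existsP; exists y; rewrite eqxx leq_maxr.
have lt_jn : j.-1 < n by have := ltn_ord v; lia.
pose u := Ordinal lt_jn; exists u, v; split; last by rewrite def_v /=; lia.
have su : t < s u.
  (* Either [u] is [x], whose value exceeds [t], or [u] lies after [x] and a value at most [t] would
     contradict the minimality of [j]. *)
  have [ux|xu] := leqP u x.
    have -> : u = x by apply: val_inj; rewrite /= in ux *; lia.
    by rewrite /t; lia.
  rewrite ltnNge; apply/negP=> su; suff: j <= u by rewrite /=; lia.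
  by apply: minj; rewrite xu; apply/existsP; exists u; rewrite eqxx.
by rewrite /low_high def_v /= /t in su sv *; lia.
Qed.

Theorem proposition1 : Av patternsA =i Av patternsB.
Proof.
case=> n s; rewrite !unfold_in /Av /patternsA /patternsB /= !andbT.
apply/idP/idP; apply: contraTT.
- rewrite !negb_and => avB.
  have [w [x [y [z lh]]]] : exists w x y z, low_high s w x y z.
    by case/or4P: avB => /low_high_of_contains[] // w [x [y [z [lh _]]]];
       exists w, x, y, z.
  (* Patterns of A are undashed only at index 1, where [adj] gives the required adjacency. *)
  have [x' [y' [/contains_of_low_high[l l_in cont] adj]]] := low_high_adjacent lh.
  move: l_in cont; rewrite !inE => /or4P[] /eqP-> cont; apply/or4P;
    [constructor 1|constructor 2|constructor 3|constructor 4];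
    by apply: cont => // -[|[|[|j]]].
- rewrite !negb_and => avA.
  have [w [x [y [z /contains_of_low_high[l l_in cont]]]]] :
      exists w x y z, low_high s w x y z.
    by case/or4P: avA => /low_high_of_contains[] // w [x [y [z [lh _]]]];
       exists w, x, y, z.
  (* Patterns of B are fully dashed, so the adjacency condition in [cont] holds vacuously. *)
  move: l_in cont; rewrite !inE => /or4P[] /eqP-> cont; apply/or4P;
    [constructor 1|constructor 2|constructor 3|constructor 4];
    by apply: cont => // -[|[|[|j]]].
Qed.
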